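(* Let $q>0$, $q\neq 1$ be fixed. Let $r\ge m\ge n\ge s$ be positive integers satisfying $r+s=m+n$, and let $\alpha_{r,m,n,s}=\dfrac{(m-1)!(n-1)!}{(r-1)!(s-1)!}$. Then the function $$x\mapsto(-1)^{m+n}\psi_q^{(m)}(x)\psi_q^{(n)}(x)-\alpha_{r,m,n,s}(-1)^{r+s}\psi_q^{(r)}(x)\psi_q^{(s)}(x)$$ is completely monotonic on $(0,\infty)$ in each of the following cases: (i) $0<q<1$ and $s=1$; (ii) $s=2$ (any $q>0$, $q\ne1$); (iii) $s=3$ and $n=4$ (any $q>0$, $q\neq 1$).
   Context: A function $f$ is completely monotonic on an interval $(a,b)$ if it has derivatives of all orders there and $(-1)^k f^{(k)}(x)\ge 0$ for all $x\in(a,b)$ and all integers $k\ge 0$. For $x>0$ and $q>0$, $q\ne 1$, the $q$-gamma function is $$\Gamma_q(x)=(1-q)^{1-x}\prod_{n=0}^{\infty}\frac{1-q^{n+1}}{1-q^{n+x}}\quad (0<q<1),$$ $$\Gamma_q(x)=(q-1)^{1-x}q^{\frac12 x(x-1)}\prod_{n=0}^{\infty}\frac{1-q^{-(n+1)}}{1-q^{-(n+x)}}\quad (q>1).$$ Let $\psi_q(x)=\frac{d}{dx}\ln\Gamma_q(x)$ be its logarithmic derivative, and let $\psi_q^{(k)}$ ($k\ge 1$) be its $k$-th derivative. *)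

(* Defs.v *)
From Stdlib Require Import Reals Factorial.
From Coquelicot Require Import Coquelicot.
Open Scope R_scope.

Definition completely_monotonic (a b : Rbar) (f : R -> R) : Prop :=
  forall x : R, Rbar_lt a x -> Rbar_lt x b ->
  forall k : nat, ex_derive_n f k x /\ 0 <= (-1) ^ k * Derive_n f k x.

(** The infinite product of [u 0], [u 1], ... as the limit of its partial
    products; the value is junk when that limit is not a finite real. *)
Definition infinite_prod (u : nat -> R) : R :=
  real (Lim_seq (fun N : nat => prod_f_R0 u N)).

(** Intended for [0 < q], [q <> 1], [0 < x]; other values are junk. *)
Definition q_gamma (q x : R) : R :=
  if Rlt_dec q 1 then
    Rpower (1 - q) (1 - x) *
    infinite_prod (fun n : nat =>
      (1 - Rpower q (INR n + 1)) / (1 - Rpower q (INR n + x)))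
  else
    Rpower (q - 1) (1 - x) * Rpower q (1 / 2 * x * (x - 1)) *
    infinite_prod (fun n : nat =>
      (1 - Rpower q (- (INR n + 1))) / (1 - Rpower q (- (INR n + x)))).

Definition q_psi (q : R) : R -> R :=
  Derive (fun x : R => ln (q_gamma q x)).

Definition alpha (r m n s : nat) : R :=
  (INR (fact (m - 1)) * INR (fact (n - 1))) /
  (INR (fact (r - 1)) * INR (fact (s - 1))).

(* Main.v *)
(** Put [p = min (q, 1/q)].  From [sum_(k >= 1) z^k / (k (1 - p^k)) =
    - sum_(n >= 0) ln (1 - z p^n)] one gets, up to a polynomial of degree at most 2
    in [x] (at most 1 if [q < 1]), [ln Gamma_q(x) = sum_k p^(k x) / (k (1 - p^k))].
    Hence [psi_q^(m)(x) = (ln p)^(m+1) sum_k k^m p^(k x) / (1 - p^k)], and the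
    function of the theorem is a power series in [p^x] whose [N]-th coefficient is,
    up to a nonnegative factor,
    [sum_(j + k = N) (j^m k^n - alpha j^r k^s) / ((1 - p^j) (1 - p^k))].
    It suffices that these coefficients are nonnegative.

    Write the summand as [(j^(m-1) k^(n-1) - alpha j^(r-1) k^(s-1)) W_j] with
    [W_j = j k / ((1 - p^j) (1 - p^k))].  As [j] moves away from [N / 2], [W_j]
    decreases, and the symmetrized first factor changes sign at most once, from
    positive to negative; so [W] can be replaced by a constant.

    It remains to compare the sums [T(a,b) = sum_(j + k = N) j^a k^b / (a! b!)]
    with [a + b] fixed.  For [s = 2], the second difference of [T(a,b) - T(a+b-1,1)]
    in [N] is nonnegative by Chebyshev's integral inequality applied to [t^(a-1)] and
    [(N - t)^(b-1)] on each unit interval; [s = 1] follows from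
    [T(c-1,1) >= T(c,0)]; and for [s = 3], [n = 4], the fourth difference of
    [T(a,3) - T(a+1,2)] is the error of Simpson's rule for [t^a]. *)

Require Import Defs.
From Stdlib Require Import Reals.
From Coquelicot Require Import Coquelicot.
From Stdlib Require Import Factorial Lra Lia.
Open Scope R_scope.

(** * Convolutions of divided powers *)

(** [auto_derive] leaves [Derive] of the abstract functions; each is replaced by the value known
    from a hypothesis, matched up to conversion. *)
Ltac rewrite_derive :=
  repeat match goal with H : is_derive ?f ?u ?l |- context [Derive ?g ?v] =>
    replace (Derive g v) with l by (symmetry; apply is_derive_unique; exact H)
  end.

Lemma derive_nonneg_le (f df : R -> R) (a b : R) :
  a <= b ->
  (forall t, a <= t <= b -> is_derive f t (df t)) ->
  (forall t, a <= t <= b -> 0 <= df t) ->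
  f a <= f b.
Proof.
intros hab hd hp.
destruct (MVT_gen f a b df) as [c [hc heq]].
- rewrite Rmin_left, Rmax_right by lra. intros; apply hd; lra.
- rewrite Rmin_left, Rmax_right by lra. intros t ht.
  apply continuity_pt_filterlim, (ex_derive_continuous f t).
  exists (df t). apply hd; lra.
- rewrite Rmin_left, Rmax_right in hc by lra.
  assert (0 <= df c * (b - a)) by (apply Rmult_le_pos; [apply hp|]; lra).
  lra.
Qed.

(** Chebyshev's integral inequality for [df] and [dh], stated with the
    antiderivatives [f], [h] and [P] of [df], [dh] and [df * dh]. *)
Lemma chebyshev_antitone (f df h dh P : R -> R) (x y : R) :
  x <= y ->
  (forall t, x <= t <= y -> is_derive f t (df t)) ->
  (forall t, x <= t <= y -> is_derive h t (dh t)) ->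
  (forall t, x <= t <= y -> is_derive P t (df t * dh t)) ->
  (forall s t, x <= s -> s <= t -> t <= y -> df s <= df t) ->
  (forall s t, x <= s -> s <= t -> t <= y -> dh t <= dh s) ->
  (y - x) * (P y - P x) <= (f y - f x) * (h y - h x).
Proof.
intros hxy Df Dh DP If Ih.
(* [K] says that the difference of the two sides, as a function of the right end [t], has
   nonnegative derivative. Its expression is itself the integral over [u] in [[x, t]] of
   [- (df t - df u) * (dh t - dh u)]. *)
assert (K : forall t, x <= t <= y ->
  0 <= df t * (h t - h x) + dh t * (f t - f x) - (P t - P x)
       - (t - x) * (df t * dh t)).
{ intros t ht.
  assert (L := derive_nonneg_le
    (fun u => df t * h u + dh t * f u - P u - u * (df t * dh t))
    (fun u => - (df t - df u) * (dh t - dh u)) x t).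
  cut (df t * h x + dh t * f x - P x - x * (df t * dh t) <=
       df t * h t + dh t * f t - P t - t * (df t * dh t)); [lra|].
  apply L; [lra| |].
  - intros u hu.
    assert (h1 := Df u ltac:(lra)). assert (h2 := Dh u ltac:(lra)).
    assert (h3 := DP u ltac:(lra)).
    auto_derive.
    + repeat split; eexists; eassumption.
    + rewrite_derive; unfold Rminus; ring.
  - intros u hu.
    assert (df u <= df t) by (apply If; lra).
    assert (dh t <= dh u) by (apply Ih; lra). nra. }
assert (L := derive_nonneg_le
  (fun t => (f t - f x) * (h t - h x) - (t - x) * (P t - P x))
  (fun t => df t * (h t - h x) + dh t * (f t - f x) - (P t - P x)
       - (t - x) * (df t * dh t)) x y hxy).
simpl in L. cut ((f x - f x) * (h x - h x) - (x - x) * (P x - P x) <=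
  (f y - f x) * (h y - h x) - (y - x) * (P y - P x)); [lra|].
apply L; [|exact K].
intros u hu.
assert (h1 := Df u ltac:(lra)). assert (h2 := Dh u ltac:(lra)).
assert (h3 := DP u ltac:(lra)).
auto_derive.
- repeat split; eexists; eassumption.
- rewrite_derive; unfold Rminus; ring.
Qed.

(** With this normalization differentiation just lowers [a], and the factor [alpha] of the theorem
    disappears. *)
Definition pow_fact (a : nat) (x : R) : R := x ^ a / INR (fact a).

Lemma pow_fact_S_0 (a : nat) : pow_fact (S a) 0 = 0.
Proof. unfold pow_fact. rewrite pow_i by lia. unfold Rdiv; ring. Qed.

Lemma pow_fact_le (a : nat) (x y : R) :
  0 <= x <= y -> pow_fact a x <= pow_fact a y.
Proof.
intros. apply Rmult_le_compat_r; [|now apply pow_incr].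
apply Rlt_le, Rinv_0_lt_compat, INR_fact_lt_0.
Qed.

Lemma is_derive_pow_fact (a : nat) (x : R) :
  is_derive (pow_fact (S a)) x (pow_fact a x).
Proof.
unfold pow_fact. auto_derive; trivial.
change (fact a + a * fact a)%nat with (S a * fact a)%nat.
rewrite mult_INR. change (match a with O => 1 | S _ => INR a + 1 end) with (INR (S a)). field.
split; [apply INR_fact_neq_0 | apply not_0_INR; lia].
Qed.

(** An antiderivative of [t^a/a! (N-t)^b/b!] (repeated integration by parts). *)
Fixpoint beta_prim (N : R) (a b : nat) (t : R) : R :=
  match b with
  | O => pow_fact (S a) t
  | S b' => pow_fact (S a) t * pow_fact b (N - t) + beta_prim N (S a) b' t
  end.

Lemma is_derive_beta_prim (N : R) (a b : nat) (t : R) :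
  is_derive (beta_prim N a b) t (pow_fact a t * pow_fact b (N - t)).
Proof.
revert a. induction b as [|b IH]; intros a.
- replace (pow_fact a t * pow_fact 0 (N - t)) with (pow_fact a t)
    by (unfold pow_fact; simpl; field; apply INR_fact_neq_0).
  apply is_derive_pow_fact.
- simpl beta_prim.
  assert (h := is_derive_plus (fun t => pow_fact (S a) t * pow_fact (S b) (N - t))
    (beta_prim N (S a) b) t
    (pow_fact a t * pow_fact (S b) (N - t) - pow_fact (S a) t * pow_fact b (N - t))
    (pow_fact (S a) t * pow_fact b (N - t))).
  match type of h with _ -> _ -> is_derive _ _ ?l =>
    replace (pow_fact a t * pow_fact (S b) (N - t)) with l
      by (match goal with |- plus ?u ?v = ?w => change (u + v = w :> R) end; ring)
  end.
  apply h; [|apply IH].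
  assert (h1 := is_derive_pow_fact a t).
  assert (h2 := is_derive_pow_fact b (N - t)).
  auto_derive.
  + split; [|split]; trivial; eexists; eassumption.
  + rewrite_derive; unfold Rminus; ring.
Qed.

Lemma beta_prim_0 (N : R) (a b : nat) : beta_prim N a b 0 = 0.
Proof.
revert a. induction b as [|b IH]; intros a; simpl; rewrite pow_fact_S_0; trivial.
rewrite IH; ring.
Qed.

(** Together with [beta_prim_0], this evaluates the beta integral over [[0, N]]. *)
Lemma beta_prim_N (N : R) (a b : nat) : beta_prim N a b N = pow_fact (S (a + b)) N.
Proof.
revert a. induction b as [|b IH]; intros a; simpl.
- now rewrite Nat.add_0_r.
- rewrite Rminus_diag, pow_fact_S_0, IH.
  replace (a + S b)%nat with (S a + b)%nat by lia. ring.
Qed.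

(** Chebyshev's inequality on [[j, j + 1]]: there [t^a/a!] increases and [(N - t)^b/b!] decreases,
    as [N - t] stays nonnegative. *)
Lemma beta_prim_step (N : R) (a b : nat) (j : R) :
  0 <= j -> j + 1 <= N ->
  beta_prim N a b (j + 1) - beta_prim N a b j <=
  (pow_fact (S a) (j + 1) - pow_fact (S a) j) *
  (pow_fact (S b) (N - j) - pow_fact (S b) (N - (j + 1))).
Proof.
intros h0 h1.
assert (h := chebyshev_antitone (pow_fact (S a)) (pow_fact a)
  (fun t => - pow_fact (S b) (N - t)) (fun t => pow_fact b (N - t))
  (beta_prim N a b) j (j + 1) ltac:(lra)).
match type of h with ?A -> ?B -> ?C -> ?D -> ?E -> ?F => assert (G : F) end.
{ refine (h _ _ _ _ _).
  - intros; apply is_derive_pow_fact.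
  - intros t ht. assert (h2 := is_derive_pow_fact b (N - t)).
    auto_derive; [repeat split; eexists; eassumption|].
    rewrite_derive; unfold Rminus; ring.
  - intros; apply is_derive_beta_prim.
  - intros; apply pow_fact_le; lra.
  - intros; apply pow_fact_le; lra. }
lra.
Qed.

(** Backward difference, i.e. multiplication of the generating series by [1 - X]. *)
Definition bdiff (u : nat -> R) (n : nat) : R :=
  match n with O => u O | S n' => u (S n') - u n' end.

Lemma bdiff_nonneg (u : nat -> R) :
  (forall n, 0 <= bdiff u n) -> forall n, 0 <= u n.
Proof.
intros h; induction n as [|n IH]; [apply (h O)|].
specialize (h (S n)); simpl in h; lra.
Qed.

Lemma bdiff_le (u v : nat -> R) :
  (forall n, bdiff u n <= bdiff v n) -> forall n, u n <= v n.
Proof.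
intros h n.
cut (0 <= v n - u n); [lra|].
apply (bdiff_nonneg (fun n => v n - u n)).
intros [|k]; [specialize (h O) | specialize (h (S k))]; simpl in *; lra.
Qed.

Lemma bdiff_ext (u v : nat -> R) :
  (forall n, u n = v n) -> forall n, bdiff u n = bdiff v n.
Proof. intros h [|n]; simpl; now rewrite !h. Qed.

(** Multiplication by [1 - X] can be moved onto either factor of a product of series, so iterated
    differences of a convolution can be distributed at will. *)
Lemma bdiff_mult_r (f g : nat -> R) (n : nat) :
  bdiff (PS_mult f g) n = PS_mult f (bdiff g) n.
Proof.
destruct n as [|n]; [reflexivity|].
unfold bdiff at 1, PS_mult. rewrite !tech5, !Nat.sub_diag.
replace (sum_f_R0 (fun k => f k * bdiff g (S n - k)) n) with
  (sum_f_R0 (fun k => f k * g (S n - k)%nat) n - sum_f_R0 (fun k => f k * g (n - k)%nat) n).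
- simpl; ring.
- rewrite <- minus_sum. apply sum_eq. intros i hi.
  replace (S n - i)%nat with (S (n - i)) by lia. simpl; ring.
Qed.

Lemma PS_mult_sym (f g : nat -> R) (n : nat) : PS_mult f g n = PS_mult g f n.
Proof.
unfold PS_mult. rewrite <- sum_f_R0_skip.
apply sum_eq. intros i hi.
replace (n - (n - i))%nat with i by lia. ring.
Qed.

Lemma bdiff_mult_l (f g : nat -> R) (n : nat) :
  bdiff (PS_mult f g) n = PS_mult (bdiff f) g n.
Proof.
rewrite (bdiff_ext _ _ (PS_mult_sym f g)), bdiff_mult_r. apply PS_mult_sym.
Qed.

Lemma PS_mult_ext (f f' g g' : nat -> R) (n : nat) :
  (forall k, f k = f' k) -> (forall k, g k = g' k) ->
  PS_mult f g n = PS_mult f' g' n.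
Proof. intros hf hg. apply sum_eq. intros; now rewrite hf, hg. Qed.

Lemma sum_f_R0_truncate (u : nat -> R) (n K : nat) :
  (K <= n)%nat -> (forall k, (K < k)%nat -> u k = 0) ->
  sum_f_R0 u n = sum_f_R0 u K.
Proof.
intros hK hu. induction hK as [|n hK IH]; [reflexivity|].
rewrite tech5, IH, hu by lia. ring.
Qed.

(** Because of the shift, a Cauchy product at index [n] runs over [j, k >= 1] with
    [j + k = n + 2]. *)
Definition pow_fact_seq (a n : nat) : R := pow_fact a (INR (S n)).

Lemma pow_fact_seq_0 (n : nat) : pow_fact_seq 0 n = 1.
Proof. unfold pow_fact_seq, pow_fact. simpl. field. Qed.

(** Index 0 fits the formula because a positive power vanishes at 0; for exponent 0 the difference
    is instead the unit of the Cauchy product. *)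
Lemma bdiff_pow_fact_seq (a n : nat) :
  bdiff (pow_fact_seq (S a)) n =
  pow_fact (S a) (INR n + 1) - pow_fact (S a) (INR n).
Proof.
rewrite <- S_INR. destruct n as [|n]; [|reflexivity].
simpl bdiff. change (INR 0) with 0. rewrite pow_fact_S_0. unfold pow_fact_seq; ring.
Qed.

Lemma bdiff_pow_fact_seq_0 (n : nat) :
  bdiff (pow_fact_seq 0) n = match n with O => 1 | _ => 0 end.
Proof. destruct n; simpl; rewrite !pow_fact_seq_0; ring. Qed.

Lemma bdiff_pow_fact_seq_1 (n : nat) :
  bdiff (pow_fact_seq 1) n = pow_fact_seq 0 n.
Proof.
rewrite bdiff_pow_fact_seq, pow_fact_seq_0.
unfold pow_fact. simpl. field.
Qed.

Lemma PS_mult_delta (f : nat -> R) (n : nat) :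
  PS_mult f (bdiff (pow_fact_seq 0)) n = f n.
Proof.
rewrite PS_mult_sym. unfold PS_mult. rewrite (sum_f_R0_truncate _ n 0).
- change (bdiff (pow_fact_seq 0) 0 * f (n - 0)%nat = f n). rewrite bdiff_pow_fact_seq_0, Nat.sub_0_r; ring.
- lia.
- intros [|k] hk; [lia|]. rewrite bdiff_pow_fact_seq_0; ring.
Qed.

(** Two differences turn the linear factor on the left into the unit, leaving a beta integral over
    [[0, n + 1]]. On the right, one difference on each factor gives products of unit increments,
    which dominate the integral interval by interval. *)
Lemma pow_fact_conv_1 (a b n : nat) :
  PS_mult (pow_fact_seq (S (a + b))) (pow_fact_seq 1) n <=
  PS_mult (pow_fact_seq (S a)) (pow_fact_seq (S b)) n.
Proof.
revert n. apply bdiff_le, bdiff_le. intros n.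
rewrite (bdiff_ext _ _ (bdiff_mult_r _ _)), bdiff_mult_r.
rewrite (PS_mult_ext _ _ _ _ n (fun _ => eq_refl)
  (bdiff_ext _ _ bdiff_pow_fact_seq_1)), PS_mult_delta.
rewrite (bdiff_ext _ _ (bdiff_mult_l _ _)), bdiff_mult_r.
unfold pow_fact_seq at 1. rewrite <- beta_prim_N.
set (N := INR (S n)).
assert (T : forall k, sum_f_R0 (fun j => beta_prim N a b (INR j + 1) - beta_prim N a b (INR j)) k
  = beta_prim N a b (INR k + 1)).
{ induction k as [|k IH]; [simpl; rewrite beta_prim_0; ring|].
  rewrite tech5, IH, S_INR. ring. }
(* Only the endpoint of the integral is rewritten; the parameter must stay [N] for the telescoping
   sum [T] to apply. *)
replace N with (INR n + 1) at 2 by (symmetry; apply S_INR).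
rewrite <- T. apply sum_Rle. intros j hj.
rewrite !bdiff_pow_fact_seq, minus_INR by lia.
assert (h := le_INR _ _ hj). assert (h0 := pos_INR j).
assert (h' : N = INR n + 1) by apply S_INR.
replace (INR n - INR j + 1) with (N - INR j) by lra.
replace (INR n - INR j) with (N - (INR j + 1)) by lra.
apply beta_prim_step; lra.
Qed.

Lemma pow_fact_step (a : nat) (x : R) :
  0 <= x -> pow_fact (S a) (x + 1) - pow_fact (S a) x <= pow_fact a (x + 1).
Proof.
intros hx.
assert (h := derive_nonneg_le (fun t => t * pow_fact a (x + 1) - pow_fact (S a) t)
  (fun t => pow_fact a (x + 1) - pow_fact a t) x (x + 1) ltac:(lra)).
simpl in h. cut (x * pow_fact a (x + 1) - pow_fact (S a) x <=
  (x + 1) * pow_fact a (x + 1) - pow_fact (S a) (x + 1)); [lra|]. apply h.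
- intros t ht. assert (h1 := is_derive_pow_fact a t).
  auto_derive; [eexists; eassumption|]. rewrite_derive. ring.
- intros t ht. assert (pow_fact a t <= pow_fact a (x + 1)) by (apply pow_fact_le; lra). lra.
Qed.

(** After two differences the left side is a unit increment of [t^(c+1)/(c+1)!], the right side its
    derivative at the right end, where it is largest. *)
Lemma pow_fact_conv_0_1 (c n : nat) :
  PS_mult (pow_fact_seq (S c)) (pow_fact_seq 0) n <=
  PS_mult (pow_fact_seq c) (pow_fact_seq 1) n.
Proof.
revert n. apply bdiff_le, bdiff_le. intros n.
rewrite (bdiff_ext _ _ (bdiff_mult_r _ _)), bdiff_mult_l, PS_mult_delta.
rewrite (bdiff_ext _ _ (bdiff_mult_r _ _)), bdiff_mult_r.
rewrite (PS_mult_ext _ _ _ _ n (fun _ => eq_refl)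
  (bdiff_ext _ _ bdiff_pow_fact_seq_1)), PS_mult_delta.
rewrite bdiff_pow_fact_seq. unfold pow_fact_seq. rewrite S_INR.
apply pow_fact_step, pos_INR.
Qed.

Lemma pow_fact_conv_0 (a b n : nat) :
  PS_mult (pow_fact_seq (a + b)) (pow_fact_seq 0) n <=
  PS_mult (pow_fact_seq a) (pow_fact_seq b) n.
Proof.
destruct b as [|b]; [rewrite Nat.add_0_r; lra|].
destruct a as [|a]; [rewrite (PS_mult_sym (pow_fact_seq 0)); apply Rle_refl|].
eapply Rle_trans; [|apply pow_fact_conv_1].
replace (S a + S b)%nat with (S (S (a + b))) by lia.
apply pow_fact_conv_0_1.
Qed.

(** Simpson's rule overestimates the integral of [t^a] over [[y, y + 2]]. *)
Lemma simpson_pow_fact (a : nat) (y : R) :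
  0 <= y ->
  (pow_fact (S a) (y + 2) - pow_fact (S a) y) / 2 <=
  (pow_fact a y + 4 * pow_fact a (y + 1) + pow_fact a (y + 2)) / 6.
Proof.
revert y. induction a as [|a IH]; intros y hy.
- unfold pow_fact; simpl. lra.
(* The error for [S a] has the error for [a] as derivative, so only [y = 0] remains to be
   checked. *)
- assert (h := derive_nonneg_le
    (fun t => (pow_fact (S a) t + 4 * pow_fact (S a) (t + 1) + pow_fact (S a) (t + 2)) / 6
      - (pow_fact (S (S a)) (t + 2) - pow_fact (S (S a)) t) / 2)
    (fun y => (pow_fact a y + 4 * pow_fact a (y + 1) + pow_fact a (y + 2)) / 6
      - (pow_fact (S a) (y + 2) - pow_fact (S a) y) / 2) 0 y hy).
  match type of h with ?A -> ?B -> ?C => assert (G : C) end.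
  { refine (h _ _).
    - intros t ht.
      assert (h1 := is_derive_pow_fact a t).
      assert (h2 := is_derive_pow_fact a (t + 1)).
      assert (h3 := is_derive_pow_fact a (t + 2)).
      assert (h4 := is_derive_pow_fact (S a) (t + 2)).
      assert (h5 := is_derive_pow_fact (S a) t).
      auto_derive; [repeat split; eexists; eassumption|].
      rewrite_derive. field.
    - intros t ht. specialize (IH t ltac:(lra)). lra. }
  simpl in G. cut (0 <= (pow_fact (S a) 0 + 4 * pow_fact (S a) (0 + 1) + pow_fact (S a) (0 + 2)) / 6
      - (pow_fact (S (S a)) (0 + 2) - pow_fact (S (S a)) 0) / 2); [lra|].
  clear G h IH hy y.
  rewrite !pow_fact_S_0. unfold pow_fact. rewrite !Rplus_0_l, pow1, (fact_simpl (S a)), mult_INR.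
  (* This is the case [y = 0] with denominators cleared. Once [a >= 4] the last factor is at least
     6; smaller [a] are computed. *)
  assert (P : 6 * 2 ^ S a <= (4 + 2 ^ S a) * INR (S (S a))).
  { destruct a as [|[|[|[|a]]]]; try (simpl; lra).
    assert (0 < 2 ^ S (S (S (S (S a))))) by (apply pow_lt; lra).
    assert (6 <= INR (S (S (S (S (S (S a))))))) by (rewrite !S_INR; pose proof (pos_INR a); lra).
    nra. }
  assert (F := INR_fact_lt_0 (S a)).
  assert (I : 0 < INR (S (S a))) by (apply lt_0_INR; lia).
  replace (_ - _) with (((4 + 2 ^ S a) * INR (S (S a)) - 6 * 2 ^ S a)
    / (6 * INR (fact (S a)) * INR (S (S a)))).
  + apply Rmult_le_pos; [lra|]. apply Rlt_le, Rinv_0_lt_compat. repeat apply Rmult_lt_0_compat; lra.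
  + rewrite <- !tech_pow_Rmult. field. lra.
Qed.

(** The squares have generating series [(1 + X) / (1 - X)^3], and the cubes
    [(1 + 4 X + X^2) / (1 - X)^4], whose numerator carries the weights of Simpson's rule. *)
Lemma bdiff_pow_fact_seq_2 (n : nat) :
  bdiff (bdiff (bdiff (pow_fact_seq 2))) n =
  match n with 0%nat | 1%nat => / 2 | _ => 0 end.
Proof.
destruct n as [|[|[|n]]]; simpl bdiff; unfold pow_fact_seq, pow_fact; simpl pow; simpl fact;
  rewrite ?S_INR; simpl INR; field.
Qed.

Lemma bdiff_pow_fact_seq_3 (n : nat) :
  bdiff (bdiff (bdiff (bdiff (pow_fact_seq 3)))) n =
  match n with 0%nat => / 6 | 1%nat => 4 / 6 | 2%nat => / 6 | _ => 0 end.
Proof.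
destruct n as [|[|[|[|n]]]]; simpl bdiff; unfold pow_fact_seq, pow_fact; simpl pow; simpl fact;
  rewrite ?S_INR; simpl INR; field.
Qed.

(** On the left three of the four differences go to the quadratic factor and one to the other,
    giving half the integral of [t^a/a!] over [[n - 1, n + 1]]; on the right all four go to the
    cubic factor, giving Simpson's value. *)
Lemma pow_fact_conv_2_3 (a n : nat) : (2 <= a)%nat ->
  PS_mult (pow_fact_seq (S a)) (pow_fact_seq 2) n <=
  PS_mult (pow_fact_seq a) (pow_fact_seq 3) n.
Proof.
intros ha. revert n. do 4 apply bdiff_le. intros n.
rewrite (bdiff_ext _ _ (bdiff_ext _ _ (bdiff_ext _ _ (bdiff_mult_r _ _)))).
rewrite (bdiff_ext _ _ (bdiff_ext _ _ (bdiff_mult_r _ _))).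
rewrite (bdiff_ext _ _ (bdiff_mult_r _ _)), bdiff_mult_l.
rewrite (bdiff_ext _ _ (bdiff_ext _ _ (bdiff_ext _ _ (bdiff_mult_r _ _)))).
rewrite (bdiff_ext _ _ (bdiff_ext _ _ (bdiff_mult_r _ _))).
rewrite (bdiff_ext _ _ (bdiff_mult_r _ _)), bdiff_mult_r.
rewrite (PS_mult_sym _ (bdiff (bdiff (bdiff (bdiff _))))).
rewrite (PS_mult_sym _ (bdiff (bdiff (bdiff _)))).
rewrite (PS_mult_ext _ _ _ _ n bdiff_pow_fact_seq_2 (bdiff_pow_fact_seq a)).
rewrite (PS_mult_ext _ _ _ _ n bdiff_pow_fact_seq_3 (fun _ => eq_refl)).
unfold PS_mult, pow_fact_seq.
destruct n as [|[|n]].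
(* At [n = 0] the interval would start at -1; the claim is [1/(2 (a+1)!) <= 1/(6 a!)], which is
   where [2 <= a] is used. *)
- simpl sum_f_R0. simpl INR. rewrite pow_fact_S_0, Rplus_0_l.
  unfold pow_fact. rewrite !pow1, fact_simpl, mult_INR.
  assert (F := INR_fact_lt_0 a).
  assert (I : 3 <= INR (S a)) by (replace 3 with (INR 3) by (simpl; ring); apply le_INR; lia).
  assert (/ (INR (S a) * INR (fact a)) <= / (3 * INR (fact a)))
    by (apply Rinv_le_contravar; [|apply Rmult_le_compat_r]; lra).
  replace (/ (3 * INR (fact a))) with (/ 3 * / INR (fact a)) in H by (field; lra).
  lra.
(* Simpson's third node is 0, where [t^a] vanishes, in agreement with the two-term convolution. *)
- assert (h := simpson_pow_fact a 0 (Rle_refl 0)).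
  simpl sum_f_R0. simpl INR. rewrite !Rplus_0_l in *.
  destruct a as [|a]; [lia|]. rewrite !pow_fact_S_0 in *.
  change (1 + 1) with 2. lra.
- rewrite !(sum_f_R0_truncate _ (S (S n)) 2)
    by (lia || (intros [|[|[|k]]] hk; try lia; apply Rmult_0_l)).
  assert (h := simpson_pow_fact a (INR n + 1) ltac:(pose proof (pos_INR n); lra)).
  cbn [sum_f_R0]. rewrite !Nat.sub_0_r.
  replace (S (S n) - 1)%nat with (S n) by lia. replace (S (S n) - 2)%nat with n by lia.
  replace (S (S (S n)) - 1)%nat with (S (S n)) by lia. replace (S (S (S n)) - 2)%nat with (S n) by lia.
  rewrite !S_INR.
  replace (INR n + 1 + 1 + 1) with (INR n + 1 + 2) by ring.
  lra.
Qed.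

(** The exponents are [m], [n], [r], [s] of the theorem lowered by one. *)
Lemma pow_fact_conv (a b c d n : nat) :
  (a <= c)%nat -> (b <= a)%nat -> (d <= b)%nat -> (c + d = a + b)%nat ->
  d = 0%nat \/ d = 1%nat \/ (d = 2%nat /\ b = 3%nat) ->
  PS_mult (pow_fact_seq c) (pow_fact_seq d) n <=
  PS_mult (pow_fact_seq a) (pow_fact_seq b) n.
Proof.
intros h1 h2 h3 h4 [-> | [-> | [-> ->]]].
- replace c with (a + b)%nat by lia. apply pow_fact_conv_0.
- destruct a as [|a]; [lia|]. destruct b as [|b]; [lia|].
  replace c with (S (a + b)) by lia. apply pow_fact_conv_1.
- replace c with (S a) by lia. apply pow_fact_conv_2_3. lia.
Qed.

(** * Reduction to constant weights *)

(** The constant [w0] separates the weights at negative values of [P] from those at positive values.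
    A new index moves it up by a maximum if its value is negative, down by a minimum if positive. *)
Lemma exists_threshold (P w : nat -> R) (n : nat) :
  (forall i, (i <= n)%nat -> 0 <= w i) ->
  (forall i j, (i <= n)%nat -> (j <= n)%nat -> P i < 0 -> 0 < P j -> w i <= w j) ->
  exists w0, 0 <= w0 /\ forall i, (i <= n)%nat -> P i * w0 <= P i * w i.
Proof.
induction n as [|n IH]; intros hw hP.
- exists (w O). split; [apply hw; lia|].
  intros i hi. replace i with O by lia. lra.
- destruct IH as [w0 [h0 h]]; [intros; apply hw; lia | intros; apply hP; trivial; lia|].
  assert (hn := hw (S n) (Nat.le_refl _)).
  destruct (Rtotal_order (P (S n)) 0) as [hneg | [hz | hpos]].
  + exists (Rmax w0 (w (S n))). split; [eapply Rle_trans; [exact h0 | apply Rmax_l]|].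
    intros i hi. destruct (Nat.eq_dec i (S n)) as [-> | hne].
    * assert (h2 := Rmax_r w0 (w (S n))). nra.
    * specialize (h i ltac:(lia)). assert (h2 := Rmax_l w0 (w (S n))).
      destruct (Rle_dec (P i) 0) as [hi0 | hi0]; [nra|].
      assert (w (S n) <= w i) by (apply hP; trivial; lra).
      assert (w0 <= w i) by nra.
      apply Rmult_le_compat_l; [lra|]. now apply Rmax_lub.
  + exists w0. split; trivial. intros i hi.
    destruct (Nat.eq_dec i (S n)) as [-> | hne]; [rewrite hz; lra|].
    apply h; lia.
  + exists (Rmin w0 (w (S n))). split; [now apply Rmin_glb|].
    intros i hi. destruct (Nat.eq_dec i (S n)) as [-> | hne].
    * assert (h2 := Rmin_r w0 (w (S n))). nra.
    * specialize (h i ltac:(lia)). assert (h2 := Rmin_l w0 (w (S n))).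
      destruct (Rle_dec 0 (P i)) as [hi0 | hi0]; [nra|].
      assert (w i <= w (S n)) by (apply hP; trivial; lra).
      assert (w i <= w0) by nra.
      assert (w i <= Rmin w0 (w (S n))) by now apply Rmin_glb. nra.
Qed.

Lemma weighted_sum_nonneg (P w : nat -> R) (n : nat) :
  (forall i, (i <= n)%nat -> 0 <= w i) ->
  (forall i j, (i <= n)%nat -> (j <= n)%nat -> P i < 0 -> 0 < P j -> w i <= w j) ->
  0 <= sum_f_R0 P n -> 0 <= sum_f_R0 (fun i => P i * w i) n.
Proof.
intros hw hP hs.
destruct (exists_threshold P w n hw hP) as [w0 [h0 h]].
apply Rle_trans with (sum_f_R0 (fun i => P i * w0) n).
- rewrite <- scal_sum. now apply Rmult_le_pos.
- now apply sum_Rle.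
Qed.

(** For [t = exp (2 u)] this is the monotonicity of [cosh ((E + 2) u) / cosh (E u)] in [u >= 0]. *)
Lemma pow_ratio_step (E : nat) (t T : R) : 1 <= t <= T ->
  (1 + t ^ (E + 2)) * (T * (1 + T ^ E)) <= (1 + T ^ (E + 2)) * (t * (1 + t ^ E)).
Proof.
intros h.
assert (h1 : t ^ S E <= T ^ S E) by (apply pow_incr; lra).
assert (h2 : 1 <= (t * T) ^ S E) by (apply pow_R1_Rle; nra).
replace (E + 2)%nat with (S (S E)) by lia.
rewrite Rpow_mult_distr in h2. simpl in *.
set (u := t ^ E) in *. set (U := T ^ E) in *.
(* The right side minus the left side is exactly the sum of this product and the next. *)
assert (0 <= (T - t) * (t * u * (T * U) - 1)) by (apply Rmult_le_pos; lra).
assert (0 <= (t * T - 1) * (T * U - t * u)) by (apply Rmult_le_pos; [nra | lra]).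
nra.
Qed.

(** The quotient [(1 + t^(e + 2 f)) / (t^f (1 + t^e))] is a product of [f] quotients, each
    increasing by [pow_ratio_step]. *)
Lemma pow_ratio (e f : nat) (t T : R) : 1 <= t <= T ->
  (1 + t ^ (e + 2 * f)) * (T ^ f * (1 + T ^ e)) <=
  (1 + T ^ (e + 2 * f)) * (t ^ f * (1 + t ^ e)).
Proof.
intros h. induction f as [|f IH].
- rewrite Nat.mul_0_r, Nat.add_0_r. simpl. lra.
- assert (hs := pow_ratio_step (e + 2 * f) t T h).
  replace (e + 2 * S f)%nat with (e + 2 * f + 2)%nat by lia.
  assert (p1 : 0 < t ^ (e + 2 * f)) by (apply pow_lt; lra).
  assert (p2 : 0 < T ^ (e + 2 * f)) by (apply pow_lt; lra).
  assert (p3 : 0 < t ^ (e + 2 * f + 2)) by (apply pow_lt; lra).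
  assert (p6 : 0 < T ^ f * (1 + T ^ e)).
  { apply Rmult_lt_0_compat; [apply pow_lt; lra|]. pose proof (pow_lt T e); lra. }
  rewrite <- !tech_pow_Rmult, !(Rmult_assoc _ (_ ^ f)).
  set (r := 1 + t ^ (e + 2 * f)) in *. set (R' := 1 + T ^ (e + 2 * f)) in *.
  set (r2 := 1 + t ^ (e + 2 * f + 2)) in *. set (R2 := 1 + T ^ (e + 2 * f + 2)) in *.
  set (s := t ^ f * (1 + t ^ e)) in *. set (S' := T ^ f * (1 + T ^ e)) in *.
  assert (hr : 0 < r) by (unfold r; lra).
  assert (hR : 0 < R') by (unfold R'; lra).
  assert (hr2 : 0 < r2) by (unfold r2; lra).
  clearbody r R' r2 R2 s S'.
  assert (q1 : 0 <= r2 * (T * R')) by (apply Rlt_le; repeat apply Rmult_lt_0_compat; lra).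
  assert (q2 : 0 <= r * S') by (apply Rlt_le; repeat apply Rmult_lt_0_compat; lra).
  assert (hm := Rmult_le_compat _ _ _ _ q1 q2 hs IH).
  apply Rmult_le_reg_l with (r * R'); [apply Rmult_lt_0_compat; lra|].
  replace (r * R' * (r2 * (T * S'))) with (r2 * (T * R') * (r * S')) by ring.
  replace (r * R' * (R2 * (t * s))) with (R2 * (t * r) * (R' * s)) by ring.
  exact hm.
Qed.

Definition sym_diff (K L : R) (a b c d : nat) (x y : R) : R :=
  K * (x ^ a * y ^ b + x ^ b * y ^ a) - L * (x ^ c * y ^ d + x ^ d * y ^ c).

Lemma sym_diff_ratio (K L : R) (a b c d : nat) (x t : R) : (c + d = a + b)%nat ->
  sym_diff K L a b c d x (x * t) =
  x ^ (a + b) * (K * (t ^ a + t ^ b) - L * (t ^ c + t ^ d)).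
Proof.
intros h. unfold sym_diff. rewrite !Rpow_mult_distr.
replace (x ^ a * (x ^ b * t ^ b)) with (x ^ (a + b) * t ^ b) by (rewrite pow_add; ring).
replace (x ^ b * (x ^ a * t ^ a)) with (x ^ (a + b) * t ^ a) by (rewrite pow_add; ring).
replace (x ^ c * (x ^ d * t ^ d)) with (x ^ (c + d) * t ^ d) by (rewrite pow_add; ring).
replace (x ^ d * (x ^ c * t ^ c)) with (x ^ (c + d) * t ^ c) by (rewrite pow_add; ring).
rewrite h. ring.
Qed.

(** By homogeneity the sign depends only on [t = y / x], which grows as the pair spreads. Since
    [c - d = (a - b) + 2 (b - d)], [pow_ratio] shows that [(t^c + t^d) / (t^a + t^b)] grows with
    [t], so a negative value cannot turn positive. *)
Lemma sym_diff_sign (K L : R) (a b c d : nat) (x y x' y' : R) :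
  (b <= a)%nat -> (d <= b)%nat -> (c + d = a + b)%nat -> 0 <= K ->
  0 < x' -> x' <= x -> x <= y -> y <= y' ->
  sym_diff K L a b c d x y < 0 -> sym_diff K L a b c d x' y' <= 0.
Proof.
intros hba hdb hs hK p1 p2 p3 p4.
assert (ht : 1 <= y / x <= y' / x').
{ split.
  - apply Rmult_le_reg_r with x; [lra|]. unfold Rdiv. rewrite Rmult_assoc, Rinv_l; lra.
  - apply Rmult_le_compat; try lra; [apply Rlt_le, Rinv_0_lt_compat; lra|].
    apply Rinv_le_contravar; lra. }
replace y with (x * (y / x)) at 1 by (field; lra).
replace y' with (x' * (y' / x')) at 1 by (field; lra).
revert ht. generalize (y / x) (y' / x'). intros t T ht.
rewrite !sym_diff_ratio by trivial.
assert (hr := pow_ratio (a - b) (b - d) t T ht).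
assert (hr' : (t ^ c + t ^ d) * (T ^ a + T ^ b) <= (T ^ c + T ^ d) * (t ^ a + t ^ b)).
{ assert (E : forall z : R, z ^ c + z ^ d = z ^ d * (1 + z ^ (a - b + 2 * (b - d)))).
  { intros z. replace c with (d + (a - b + 2 * (b - d)))%nat at 1 by lia. rewrite pow_add. ring. }
  assert (E' : forall z : R, z ^ a + z ^ b = z ^ d * (z ^ (b - d) * (1 + z ^ (a - b)))).
  { intros z. replace a with (d + ((b - d) + (a - b)))%nat at 1 by lia.
    replace b with (d + (b - d))%nat at 3 by lia. rewrite !pow_add. ring. }
  rewrite !E, !E'.
  assert (0 < t ^ d * T ^ d) by (apply Rmult_lt_0_compat; apply pow_lt; lra).
  nra. }
intros hneg.
assert (q1 : 0 < x ^ (a + b)) by (apply pow_lt; lra).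
assert (q2 : 0 < x' ^ (a + b)) by (apply pow_lt; lra).
assert (q3 : K * (t ^ a + t ^ b) - L * (t ^ c + t ^ d) < 0) by nra.
cut (K * (T ^ a + T ^ b) - L * (T ^ c + T ^ d) <= 0); [nra|].
assert (pos : forall z k, 1 <= z -> 0 < z ^ k) by (intros; apply pow_lt; lra).
assert (0 < t ^ a + t ^ b) by (apply Rplus_lt_0_compat; apply pos; lra).
assert (0 < t ^ c + t ^ d) by (apply Rplus_lt_0_compat; apply pos; lra).
assert (0 < T ^ a + T ^ b) by (apply Rplus_lt_0_compat; apply pos; lra).
set (ta := t ^ a + t ^ b) in *. set (tc := t ^ c + t ^ d) in *.
set (Ta := T ^ a + T ^ b) in *. set (Tc := T ^ c + T ^ d) in *.
assert (0 <= L) by nra.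
apply Rmult_le_reg_r with ta; [lra|].
assert (K * ta * Ta <= L * tc * Ta) by (apply Rmult_le_compat_r; lra).
assert (L * (tc * Ta) <= L * (Tc * ta)) by (apply Rmult_le_compat_l; lra).
lra.
Qed.

(** [2 sinh (l h)] for [h = - ln tau]. *)
Definition sinh_seq (tau : R) (l : nat) : R := / tau ^ l - tau ^ l.

Lemma sinh_seq_nonneg (tau : R) (l : nat) : 0 < tau < 1 -> 0 <= sinh_seq tau l.
Proof.
intros h. unfold sinh_seq.
assert (0 < tau ^ l) by (apply pow_lt; lra).
assert (tau ^ l <= 1 ^ l) by (apply pow_incr; lra). rewrite pow1 in *.
assert (1 <= / tau ^ l) by (rewrite <- Rinv_1; apply Rinv_le_contravar; lra).
lra.
Qed.

(** [sinh ((l+2) h) + sinh (l h) = 2 cosh h sinh ((l+1) h)], and [2 cosh h = tau + 1/tau >= 2]. *)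
Lemma sinh_seq_convex (tau : R) (l : nat) : 0 < tau < 1 ->
  2 * sinh_seq tau (S l) <= sinh_seq tau (S (S l)) + sinh_seq tau l.
Proof.
intros h.
assert (0 < tau ^ l) by (apply pow_lt; lra).
assert (E : sinh_seq tau (S (S l)) + sinh_seq tau l = (tau + / tau) * sinh_seq tau (S l)).
{ unfold sinh_seq. simpl. field. lra. }
rewrite E. apply Rmult_le_compat_r; [now apply sinh_seq_nonneg|].
assert (0 < / tau) by (apply Rinv_0_lt_compat; lra).
assert (tau * / tau = 1) by (field; lra). nra.
Qed.

(** A convex sequence vanishing at 0 has nondecreasing ratio to its index. *)
Lemma sinh_seq_ratio (tau : R) (k l : nat) : 0 < tau < 1 -> (1 <= k <= l)%nat ->
  INR l * sinh_seq tau k <= INR k * sinh_seq tau l.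
Proof.
intros h [hk hl].
assert (st : forall n, INR (S n) * sinh_seq tau n <= INR n * sinh_seq tau (S n)).
{ induction n as [|n IH].
  - unfold sinh_seq; simpl. rewrite Rinv_1. lra.
  - assert (hc := sinh_seq_convex tau n h). rewrite !S_INR in *.
    assert (h0 := pos_INR n). nra. }
induction hl as [|l hl IH]; [lra|].
specialize (st l).
assert (0 < INR l) by (apply lt_0_INR; lia).
assert (0 < INR (S l)) by (apply lt_0_INR; lia).
assert (0 < INR k) by (apply lt_0_INR; lia).
apply Rmult_le_reg_l with (INR l); [trivial|].
apply Rle_trans with (INR (S l) * (INR k * sinh_seq tau l)).
- rewrite <- Rmult_assoc, (Rmult_comm (INR l)), Rmult_assoc.
  apply Rmult_le_compat_l; lra.
- nra.
Qed.

Definition q_weight (p : R) (l : nat) : R := INR l / (1 - p ^ l).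

Lemma pow_lt_1 (p : R) (l : nat) : 0 < p < 1 -> 0 < p ^ S l < 1.
Proof.
intros h. split; [apply pow_lt; lra|].
apply pow_lt_1_compat; [lra | lia].
Qed.

Lemma q_weight_pos (p : R) (l : nat) : 0 < p < 1 -> 0 < q_weight p (S l).
Proof.
intros h. assert (h1 := pow_lt_1 p l h).
apply Rdiv_lt_0_compat; [apply lt_0_INR; lia | lra].
Qed.

(** With [tau = sqrt p], [1 - p^l = tau^l * sinh_seq tau l]. The powers of [tau] cancel, both pairs
    of indices having the same sum, and a comparison of integers with hyperbolic sines remains. *)
Lemma q_weight_step (p : R) (i d : nat) : 0 < p < 1 ->
  q_weight p (S i) * q_weight p (S (S (S i) + d)) <=
  q_weight p (S (S i)) * q_weight p (S (S i) + d).
Proof.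
intros hp.
set (tau := sqrt p).
assert (ht : 0 < tau < 1).
{ split; [apply sqrt_lt_R0; lra|]. unfold tau. rewrite <- sqrt_1. apply sqrt_lt_1; lra. }
assert (E : forall l, q_weight p (S l) = INR (S l) / (tau ^ S l * sinh_seq tau (S l))).
{ intros l. unfold q_weight, sinh_seq.
  assert (0 < tau ^ S l) by (apply pow_lt; lra).
  replace p with (tau * tau) by (apply sqrt_sqrt; lra).
  rewrite Rpow_mult_distr. f_equal. field. lra. }
assert (pos : forall l, 0 < sinh_seq tau (S l)).
{ intros l. unfold sinh_seq. assert (h := pow_lt_1 tau l ht).
  assert (1 < / tau ^ S l) by (rewrite <- Rinv_1; apply Rinv_lt_contravar; lra). lra. }
assert (r1 := sinh_seq_ratio tau 1 (S i) ht ltac:(lia)).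
assert (r2 := sinh_seq_ratio tau (S d) (S (S (S i) + d)) ht ltac:(lia)).
(* The product formula for hyperbolic sines; [N] below is the same identity for the indices
   themselves. Subtracting the common term leaves the product of [r1] and [r2]. *)
assert (D : sinh_seq tau (S (S i)) * sinh_seq tau (S (S i) + d) =
  sinh_seq tau (S i) * sinh_seq tau (S (S (S i) + d)) + sinh_seq tau 1 * sinh_seq tau (S d)).
{ unfold sinh_seq. assert (0 < tau ^ i) by (apply pow_lt; lra).
  assert (0 < tau ^ d) by (apply pow_lt; lra).
  simpl. rewrite !pow_add. field. lra. }
assert (N : INR (S (S i)) * INR (S (S i) + d) =
  INR (S i) * INR (S (S (S i) + d)) + INR (S d)).
{ rewrite <- !mult_INR, <- plus_INR. f_equal. lia. }
change (S (S i) + d)%nat with (S (S i + d)) in *.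
rewrite !E.
assert (P : tau ^ S (S i) * tau ^ S (S i + d) = tau ^ S i * tau ^ S (S (S i + d))).
{ rewrite <- !pow_add. f_equal. lia. }
revert D N P r1 r2.
assert (q1 := pos i). assert (q2 := pos (S i)). assert (q3 := pos (S i + d)%nat).
assert (q4 := pos (S (S i + d))%nat). assert (q5 := pos d). assert (q6 := pos O).
assert (i1 : 0 < INR (S i)) by (apply lt_0_INR; lia).
assert (i2 : 0 < INR (S d)) by (apply lt_0_INR; lia).
assert (i3 : 0 < INR (S (S (S i + d)))) by (apply lt_0_INR; lia).
assert (u1 : 0 < tau ^ S i) by (apply pow_lt; lra).
assert (u2 : 0 < tau ^ S (S i)) by (apply pow_lt; lra).
assert (u3 : 0 < tau ^ S (S i + d)) by (apply pow_lt; lra).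
assert (u4 : 0 < tau ^ S (S (S i + d))) by (apply pow_lt; lra).
change (INR 1) with 1.
generalize dependent (tau ^ S i). generalize dependent (tau ^ S (S i)).
generalize dependent (tau ^ S (S i + d)). generalize dependent (tau ^ S (S (S i + d))).
generalize dependent (sinh_seq tau (S i)). generalize dependent (sinh_seq tau (S (S i))).
generalize dependent (sinh_seq tau (S (S i + d))).
generalize dependent (sinh_seq tau (S (S (S i + d)))).
generalize dependent (sinh_seq tau (S d)). generalize dependent (sinh_seq tau 1).
generalize dependent (INR (S i)). generalize dependent (INR (S (S i))).
generalize dependent (INR (S (S i + d))). generalize dependent (INR (S (S (S i + d)))).
generalize dependent (INR (S d)).
clear.
intros nd nd0 nL nL0 nk nj ni ni0 c1 c10 cd cd0 cL cL0 ck ck0 cj cj0 ci ci0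
  pL pL0 pk pk0 pj pj0 pi pi0 D N P r1 r2.
assert (M : ni * nL * (cj * ck) <= nj * nk * (ci * cL)).
{ rewrite D, N.
  assert (ni * c1 * (nL * cd) <= ci * (nd * cL)) by (apply Rmult_le_compat; nra).
  lra. }
replace (ni / (pi * ci) * (nL / (pL * cL))) with (ni * nL * (cj * ck) / (pj * pk * (cj * ck * (ci * cL))))
  by (rewrite P; field; repeat split; apply Rgt_not_eq; trivial).
replace (nj / (pj * cj) * (nk / (pk * ck))) with (nj * nk * (ci * cL) / (pj * pk * (cj * ck * (ci * cL))))
  by (field; repeat split; apply Rgt_not_eq; trivial).
apply Rmult_le_compat_r; [|trivial].
apply Rlt_le, Rinv_0_lt_compat. repeat apply Rmult_lt_0_compat; trivial.
Qed.

Lemma q_weight_unimodal (p : R) (i e d : nat) : 0 < p < 1 ->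
  q_weight p (S i) * q_weight p (S i + e + e + d) <=
  q_weight p (S i + e) * q_weight p (S i + e + d).
Proof.
intros hp. revert i d. induction e as [|e IH]; intros i d.
- rewrite !Nat.add_0_r. lra.
- eapply Rle_trans; [|eapply Rle_trans; [apply (IH (S i) d)|]].
  + assert (h := q_weight_step p i (e + e + d) hp).
    replace (S i + S e + S e + d)%nat with (S (S (S i) + (e + e + d))) by lia.
    replace (S (S i) + e + e + d)%nat with (S (S i) + (e + e + d))%nat by lia.
    exact h.
  + replace (S i + S e)%nat with (S (S i) + e)%nat by lia. lra.
Qed.

Lemma PS_mult_weighted (f g v : nat -> R) (n : nat) :
  PS_mult (fun j => f j * v j) (fun j => g j * v j) n =
  sum_f_R0 (fun i => (f i * g (n - i)%nat) * (v i * v (n - i)%nat)) n.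
Proof. apply sum_eq. intros; ring. Qed.

(** The terms [i] and [n - i] carry the same weight, so the difference of the two sides is half the
    sum of [P i * w i], with [P] the symmetrized difference. *)
Lemma weighted_conv (p : R) (a b c d n : nat) : 0 < p < 1 ->
  (a <= c)%nat -> (b <= a)%nat -> (d <= b)%nat -> (c + d = a + b)%nat ->
  d = 0%nat \/ d = 1%nat \/ (d = 2%nat /\ b = 3%nat) ->
  PS_mult (fun j => pow_fact_seq c j * q_weight p (S j))
          (fun j => pow_fact_seq d j * q_weight p (S j)) n <=
  PS_mult (fun j => pow_fact_seq a j * q_weight p (S j))
          (fun j => pow_fact_seq b j * q_weight p (S j)) n.
Proof.
intros hp h1 h2 h3 h4 h5.
assert (h := pow_fact_conv a b c d n h1 h2 h3 h4 h5).
rewrite !PS_mult_weighted.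
set (Q := fun i => pow_fact_seq a i * pow_fact_seq b (n - i)%nat
                   - pow_fact_seq c i * pow_fact_seq d (n - i)%nat).
set (w := fun i => q_weight p (S i) * q_weight p (S (n - i))).
set (K := / (INR (fact a) * INR (fact b))). set (L := / (INR (fact c) * INR (fact d))).
set (P := fun i => sym_diff K L a b c d (INR (S i)) (INR (S (n - i)))).
assert (hQ : forall i, (i <= n)%nat -> Q i + Q (n - i)%nat = P i).
{ intros i hi. unfold Q, P, sym_diff, K, L, pow_fact_seq, pow_fact.
  replace (n - (n - i))%nat with i by lia.
  pose proof (INR_fact_neq_0 a). pose proof (INR_fact_neq_0 b).
  pose proof (INR_fact_neq_0 c). pose proof (INR_fact_neq_0 d). field. tauto. }
assert (hw : forall i, (i <= n)%nat -> w (n - i)%nat = w i).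
{ intros i hi. unfold w. replace (n - (n - i))%nat with i by lia. ring. }
assert (hP : forall i, (i <= n)%nat -> P (n - i)%nat = P i).
{ intros i hi. rewrite <- !hQ by lia. replace (n - (n - i))%nat with i by lia. ring. }
assert (half : forall i, (i <= n)%nat ->
  exists i', (2 * i' <= n)%nat /\ P i' = P i /\ w i' = w i).
{ intros i hi. destruct (Nat.le_gt_cases (2 * i) n) as [hl | hl].
  - exists i. auto.
  - exists (n - i)%nat. split; [lia|]. auto. }
assert (X : 0 <= sum_f_R0 (fun i => P i * w i) n).
{ apply weighted_sum_nonneg.
  - intros i hi. apply Rlt_le, Rmult_lt_0_compat; apply q_weight_pos; trivial.
  - intros i j hi hj hPi hPj.
    destruct (half i hi) as (i' & hi' & <- & <-) in hPi |- *.
    destruct (half j hj) as (j' & hj' & <- & <-) in hPj |- *.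
    (* Both indices are now at most [n / 2]. If [j'] is nearer the middle, its weight is larger; if
       it is farther out, [sym_diff_sign] forbids a positive value there. *)
    destruct (Nat.le_gt_cases i' j') as [hl | hl].
    + assert (u := q_weight_unimodal p i' (j' - i') (n - 2 * j') hp).
      unfold w.
      replace (S i' + (j' - i') + (j' - i') + (n - 2 * j'))%nat with (S (n - i')) in u by lia.
      replace (S i' + (j' - i') + (n - 2 * j'))%nat with (S (n - j')) in u by lia.
      replace (S i' + (j' - i'))%nat with (S j') in u by lia. exact u.
    + exfalso. apply (Rlt_not_le _ _ hPj).
      apply (sym_diff_sign K L a b c d (INR (S i')) (INR (S (n - i')))); trivial.
      * apply Rlt_le, Rinv_0_lt_compat, Rmult_lt_0_compat; apply INR_fact_lt_0.
      * apply lt_0_INR; lia.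
      * apply le_INR; lia.
      * apply le_INR; lia.
      * apply le_INR; lia.
  - rewrite (sum_eq P (fun i => Q i + Q (n - i)%nat)) by (intros; symmetry; auto).
    rewrite plus_sum, (sum_f_R0_skip Q).
    unfold Q. rewrite minus_sum. unfold PS_mult in h. lra. }
rewrite (sum_eq _ (fun i => Q i * w i + Q (n - i)%nat * w (n - i)%nat)) in X.
2: { intros i hi. rewrite hw, <- hQ by trivial. ring. }
rewrite plus_sum, (sum_f_R0_skip (fun i => Q i * w i)) in X.
cut (0 <= sum_f_R0 (fun i => Q i * w i) n); [|lra].
rewrite (sum_eq _ (fun i => pow_fact_seq a i * pow_fact_seq b (n - i)%nat * w i
  - pow_fact_seq c i * pow_fact_seq d (n - i)%nat * w i)) by (intros; unfold Q; ring).
rewrite minus_sum. unfold w. lra.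
Qed.

(** Coefficients of [sum_k k^m z^k / (1 - p^k)]; for [m > 0] the junk value
    [0 ^ m / 0] at [k = 0] is [0], as it should be. *)
Definition psi_coef (p : R) (m k : nat) : R := INR k ^ m / (1 - p ^ k).

Lemma psi_coef_0 (p : R) (m : nat) : psi_coef p (S m) 0 = 0.
Proof. unfold psi_coef. simpl. unfold Rdiv. ring. Qed.

Lemma psi_coef_S (p : R) (m k : nat) :
  psi_coef p (S m) (S k) = INR (fact m) * (pow_fact_seq m k * q_weight p (S k)).
Proof.
unfold psi_coef, pow_fact_seq, pow_fact, q_weight, Rdiv.
rewrite <- tech_pow_Rmult.
assert (h : INR (fact m) * / INR (fact m) = 1) by (apply Rinv_r, INR_fact_neq_0).
transitivity (INR (fact m) * / INR (fact m) * (INR (S k) * INR (S k) ^ m * / (1 - p ^ S k)));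
  [rewrite h; ring | ring].
Qed.

Lemma PS_mult_shift (u v : nat -> R) (n : nat) : u O = 0 -> v O = 0 ->
  PS_mult u v (S (S n)) = PS_mult (fun k => u (S k)) (fun k => v (S k)) n.
Proof.
intros hu hv. unfold PS_mult.
rewrite tech5, Nat.sub_diag, hv, (decomp_sum _ (S n)), hu by lia.
simpl pred. rewrite Rmult_0_l, Rplus_0_l, Rmult_0_r, Rplus_0_r.
apply sum_eq. intros i hi. now replace (S (S n) - S i)%nat with (S (n - i)) by lia.
Qed.

Lemma PS_mult_scal (f g : nat -> R) (x y : R) (n : nat) :
  PS_mult (fun k => x * f k) (fun k => y * g k) n = x * y * PS_mult f g n.
Proof.
unfold PS_mult. rewrite scal_sum. apply sum_eq. intros; ring.
Qed.

(** Coefficients 0 and 1 vanish; coefficient [N + 2] is the weighted convolution at index [N], whose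
    factorials absorb [alpha]. *)
Lemma psi_coef_conv (p : R) (r m n s N : nat) : 0 < p < 1 ->
  (m <= r)%nat -> (n <= m)%nat -> (s <= n)%nat -> (1 <= s)%nat ->
  (r + s = m + n)%nat ->
  s = 1%nat \/ s = 2%nat \/ (s = 3%nat /\ n = 4%nat) ->
  alpha r m n s * PS_mult (psi_coef p r) (psi_coef p s) N <=
  PS_mult (psi_coef p m) (psi_coef p n) N.
Proof.
intros hp h1 h2 h3 h4 h5 h6.
destruct r as [|r]; [lia|]. destruct m as [|m]; [lia|].
destruct n as [|n]; [lia|]. destruct s as [|s]; [lia|].
destruct N as [|[|N]].
- unfold PS_mult; simpl. rewrite !psi_coef_0. lra.
- unfold PS_mult; simpl. rewrite !psi_coef_0. lra.
- rewrite !PS_mult_shift by apply psi_coef_0.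
  rewrite (PS_mult_ext _ _ _ _ N (psi_coef_S p r) (psi_coef_S p s)).
  rewrite (PS_mult_ext _ _ _ _ N (psi_coef_S p m) (psi_coef_S p n)).
  rewrite !PS_mult_scal. unfold alpha.
  replace (S m - 1)%nat with m by lia. replace (S n - 1)%nat with n by lia.
  replace (S r - 1)%nat with r by lia. replace (S s - 1)%nat with s by lia.
  assert (h := weighted_conv p m n r s N hp ltac:(lia) ltac:(lia) ltac:(lia) ltac:(lia) ltac:(lia)).
  rewrite <- Rmult_assoc.
  replace (_ / _ * _) with (INR (fact m) * INR (fact n)).
  + apply Rmult_le_compat_l; [|exact h].
    apply Rlt_le, Rmult_lt_0_compat; apply INR_fact_lt_0.
  + field. split; apply INR_fact_neq_0.
Qed.

(** * The q-gamma function as a power series in [p^x] *)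

Lemma CV_radius_ge_1 (a : nat -> R) :
  (forall z, 0 <= z < 1 -> ex_pseries a z) -> Rbar_le 1 (CV_radius a).
Proof.
intros h. assert (h0 := CV_radius_ge_0 a).
destruct (CV_radius a) as [c | | ] eqn:E; [|exact I | exact h0].
simpl in *. apply Rnot_lt_le. intros hc.
(* A point between the supposed radius [c] and 1, where the terms would not tend to 0. *)
assert (hz : 0 <= (c + 1) / 2 < 1) by lra.
apply (CV_disk_outside a ((c + 1) / 2)).
- rewrite E, Rabs_pos_eq by lra. simpl. lra.
- apply ex_series_lim_0. destruct (h _ hz) as [l hl]. exists l.
  apply is_pseries_R. exact hl.
Qed.

Lemma Rbar_lt_radius (a : nat -> R) (z : R) :
  Rbar_le 1 (CV_radius a) -> 0 <= z < 1 -> Rbar_lt (Rabs z) (CV_radius a).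
Proof.
intros h hz. eapply Rbar_lt_le_trans; [|exact h].
rewrite Rabs_pos_eq by lra. simpl. lra.
Qed.

(** Coefficients of [(z d/dz)^k] applied to the series of [a]. For [z = p^x], [d/dx] acts as [ln p]
    times [z d/dz]. *)
Definition theta (k : nat) (a : nat -> R) (j : nat) : R := INR j ^ k * a j.

Lemma PS_incr_derive (k : nat) (a : nat -> R) (j : nat) :
  PS_incr_1 (PS_derive (theta k a)) j = theta (S k) a j.
Proof.
destruct j as [|j]; unfold theta; rewrite <- tech_pow_Rmult.
- change (0 = 0 * INR 0 ^ k * a O). ring.
- change (INR (S j) * (INR (S j) ^ k * a (S j)) = INR (S j) * INR (S j) ^ k * a (S j)). ring.
Qed.

Lemma CV_radius_theta (k : nat) (a : nat -> R) : CV_radius (theta k a) = CV_radius a.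
Proof.
induction k as [|k IH].
- apply CV_radius_ext. intros; unfold theta; simpl; ring.
- rewrite <- (CV_radius_ext _ _ (PS_incr_derive k a)), CV_radius_incr_1, CV_radius_derive.
  exact IH.
Qed.

Lemma Rpower_lt_1 (p x : R) : 0 < p < 1 -> 0 < x -> 0 < Rpower p x < 1.
Proof.
intros hp hx. split; [apply exp_pos|].
unfold Rpower. rewrite <- exp_0. apply exp_increasing.
assert (ln p < 0) by (rewrite <- ln_1; apply ln_increasing; lra). nra.
Qed.

Lemma locally_pos (x : R) (P : R -> Prop) :
  0 < x -> (forall y, 0 < y -> P y) -> locally x P.
Proof.
intros hx h. apply (locally_interval P x 0 p_infty); simpl; trivial. intros; auto.
Qed.

Lemma is_derive_PSeries_Rpower (p : R) (a : nat -> R) (k : nat) (x : R) :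
  0 < p < 1 -> Rbar_le 1 (CV_radius a) -> 0 < x ->
  is_derive (fun y => PSeries (theta k a) (Rpower p y)) x
    (ln p * PSeries (theta (S k) a) (Rpower p x)).
Proof.
intros hp ha hx.
rewrite <- (PSeries_ext _ _ _ (PS_incr_derive k a)), PSeries_incr_1.
assert (h1 : is_derive (PSeries (theta k a)) (Rpower p x)
  (PSeries (PS_derive (theta k a)) (Rpower p x))).
{ apply is_derive_PSeries, Rbar_lt_radius.
  - now rewrite CV_radius_theta.
  - assert (h := Rpower_lt_1 p x hp hx). lra. }
assert (h2 : is_derive (fun y => Rpower p y) x (ln p * Rpower p x)).
{ unfold Rpower. auto_derive; [trivial | ring]. }
assert (h := is_derive_comp _ _ _ _ _ h1 h2).
rewrite <- Rmult_assoc. exact h.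
Qed.

Lemma is_derive_n_PSeries_Rpower (p : R) (a : nat -> R) (k : nat) (x : R) :
  0 < p < 1 -> Rbar_le 1 (CV_radius a) -> 0 < x ->
  is_derive_n (fun y => PSeries a (Rpower p y)) k x
    (ln p ^ k * PSeries (theta k a) (Rpower p x)).
Proof.
intros hp ha. revert x. induction k as [|k IH]; intros x hx.
- simpl. rewrite Rmult_1_l. apply PSeries_ext. intros; unfold theta; simpl; ring.
- apply is_derive_ext_loc with (fun y => ln p ^ k * PSeries (theta k a) (Rpower p y)).
  + apply locally_pos; trivial. intros y hy. symmetry.
    apply is_derive_n_unique, IH, hy.
  + rewrite <- tech_pow_Rmult, (Rmult_comm (ln p)), Rmult_assoc.
    apply (is_derive_scal (fun y => PSeries (theta k a) (Rpower p y))).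
    now apply is_derive_PSeries_Rpower.
Qed.

(** Coefficients of the derivative of [log_qexp]; [PS_Int] supplies the factor [1/k] and the zero
    constant term. *)
Definition log_coef (p : R) (k : nat) : R := / (1 - p ^ S k).

(** [log_qexp p z = sum_(k >= 1) z^k / (k (1 - p^k)) = - sum_(n >= 0) ln (1 - z p^n)]. *)
Definition log_qexp (p : R) : R -> R := PSeries (PS_Int (log_coef p)).

Lemma CV_radius_log_coef (p : R) : 0 < p < 1 -> Rbar_le 1 (CV_radius (log_coef p)).
Proof.
intros hp. apply CV_radius_ge_1. intros z hz.
apply ex_pseries_R.
apply (ex_series_le (fun k => log_coef p k * z ^ k : R_CompleteNormedModule) (fun k => / (1 - p) * z ^ k)).
- intros k. change (norm (log_coef p k * z ^ k)) with (Rabs (log_coef p k * z ^ k)).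
  assert (h := pow_lt_1 p k hp).
  assert (0 <= z ^ k) by (apply pow_le; lra).
  assert (p ^ S k <= p).
  { simpl. assert (p ^ k <= 1 ^ k) by (apply pow_incr; lra). rewrite pow1 in *. nra. }
  assert (0 < / (1 - p ^ S k)) by (apply Rinv_0_lt_compat; lra).
  unfold log_coef. rewrite Rabs_pos_eq by (apply Rmult_le_pos; lra).
  apply Rmult_le_compat_r; trivial. apply Rinv_le_contravar; lra.
- apply (ex_series_scal_l (/ (1 - p)) (fun k => z ^ k)). exists (/ (1 - z)).
  apply is_series_geom. rewrite Rabs_pos_eq; lra.
Qed.

Lemma is_derive_log_qexp (p z : R) : 0 < p < 1 -> 0 <= z < 1 ->
  is_derive (log_qexp p) z (PSeries (log_coef p) z).
Proof.
intros hp hz.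
rewrite <- (PSeries_ext (PS_derive (PS_Int (log_coef p)))).
- apply is_derive_PSeries. apply Rbar_lt_radius; trivial.
  rewrite CV_radius_Int. now apply CV_radius_log_coef.
- intros k. unfold PS_derive, PS_Int. simpl pred. field. apply not_0_INR; lia.
Qed.

Lemma PSeries_log_coef (p z : R) : 0 < p < 1 -> 0 <= z < 1 ->
  PSeries (log_coef p) z - p * PSeries (log_coef p) (p * z) = / (1 - z).
Proof.
intros hp hz.
assert (ex : forall z, 0 <= z < 1 -> ex_series (fun k => log_coef p k * z ^ k)).
{ intros y hy. apply ex_pseries_R, CV_radius_inside, Rbar_lt_radius; trivial.
  now apply CV_radius_log_coef. }
unfold PSeries. rewrite <- Series_scal_l, <- Series_minus.
- rewrite <- Series_geom by (rewrite Rabs_pos_eq; lra).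
  apply Series_ext. intros k. rewrite Rpow_mult_distr. unfold log_coef.
  assert (h := pow_lt_1 p k hp). simpl in *. field. lra.
- now apply ex.
- apply (ex_series_scal_l p (fun k => log_coef p k * (p * z) ^ k)). apply ex. nra.
Qed.

(** Both sides agree at 0, and [PSeries_log_coef] says that their derivatives coincide. This makes
    the partial products of the q-gamma function telescope. *)
Lemma log_qexp_functional (p z : R) : 0 < p < 1 -> 0 <= z < 1 ->
  log_qexp p (p * z) = log_qexp p z + ln (1 - z).
Proof.
intros hp hz.
destruct (Req_dec z 0) as [-> | hz0].
{ rewrite Rmult_0_r, Rminus_0_r, ln_1. ring. }
assert (h : log_qexp p 0 + ln (1 - 0) - log_qexp p (p * 0) =
  log_qexp p z + ln (1 - z) - log_qexp p (p * z)).
{ apply (eq_is_derive (fun t => log_qexp p t + ln (1 - t) - log_qexp p (p * t)) 0 z); [|lra].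
  intros t ht.
  assert (h1 := is_derive_log_qexp p t hp ltac:(lra)).
  assert (h2 := is_derive_log_qexp p (p * t) hp ltac:(nra)).
  assert (h3 := PSeries_log_coef p t hp ltac:(lra)).
  change zero with 0. auto_derive.
  - repeat split; try (eexists; eassumption); lra.
  - rewrite_derive. unfold Rminus, Rdiv in *. lra. }
rewrite Rmult_0_r, Rminus_0_r, ln_1 in h. lra.
Qed.

Lemma prod_q_gamma (p x : R) (N : nat) : 0 < p < 1 -> 0 < x ->
  prod_f_R0 (fun n => (1 - Rpower p (INR n + 1)) / (1 - Rpower p (INR n + x))) N =
  exp (log_qexp p (Rpower p x) - log_qexp p p
       - (log_qexp p (p ^ S N * Rpower p x) - log_qexp p (p ^ S N * p))).
Proof.
intros hp hx.
assert (pw : forall n y, Rpower p (INR n + y) = p ^ n * Rpower p y).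
{ intros n y. rewrite Rpower_plus, Rpower_pow; lra. }
assert (hx1 := Rpower_lt_1 p x hp hx).
assert (p1 : Rpower p 1 = p) by (apply Rpower_1; lra).
assert (st : forall n, (1 - Rpower p (INR n + 1)) / (1 - Rpower p (INR n + x)) =
  exp (log_qexp p (p ^ n * Rpower p x) - log_qexp p (p ^ n * p)
       - (log_qexp p (p ^ S n * Rpower p x) - log_qexp p (p ^ S n * p)))).
{ intros n. rewrite !pw, p1.
  assert (hn : 0 < p ^ n <= 1).
  { split; [apply pow_lt; lra|]. rewrite <- (pow1 n). apply pow_incr; lra. }
  simpl pow. rewrite !(Rmult_assoc p), !log_qexp_functional by (trivial; nra).
  replace (_ - _ - _) with (ln (1 - p ^ n * p) + - ln (1 - p ^ n * Rpower p x)) by ring.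
  rewrite exp_plus, exp_Ropp, !exp_ln by nra. reflexivity. }
induction N as [|N IH].
- cbn [prod_f_R0]. rewrite st, !pow_O, !Rmult_1_l. reflexivity.
- cbn [prod_f_R0]. rewrite IH, st, <- exp_plus. f_equal. ring.
Qed.

Lemma infinite_prod_q_gamma (p x : R) : 0 < p < 1 -> 0 < x ->
  infinite_prod (fun n => (1 - Rpower p (INR n + 1)) / (1 - Rpower p (INR n + x))) =
  exp (log_qexp p (Rpower p x) - log_qexp p p).
Proof.
intros hp hx. unfold infinite_prod.
erewrite Lim_seq_ext by (intros N; exact (prod_q_gamma p x N hp hx)).
(* The two remainder terms of the telescoped product share this limit and cancel. *)
assert (t0 : forall c, is_lim_seq (fun N => log_qexp p (p ^ S N * c)) (log_qexp p 0)).
{ intros c. apply is_lim_seq_continuous.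
  - apply continuity_pt_filterlim, (ex_derive_continuous (log_qexp p)).
    eexists. apply is_derive_log_qexp; lra.
  - replace (Finite 0) with (Rbar_mult 0 c) by (simpl; now rewrite Rmult_0_l).
    apply is_lim_seq_mult with 0 c.
    + apply (is_lim_seq_incr_1 (fun N => p ^ N)), is_lim_seq_geom. rewrite Rabs_pos_eq; lra.
    + apply is_lim_seq_const.
    + apply Rbar_mult_correct. exact I. }
rewrite (is_lim_seq_unique _ (exp (log_qexp p (Rpower p x) - log_qexp p p))); [reflexivity|].
apply (is_lim_seq_continuous exp).
- apply derivable_continuous_pt, derivable_pt_exp.
- generalize (log_qexp p (Rpower p x) - log_qexp p p). intros A.
  assert (h := is_lim_seq_minus' _ _ _ _ (is_lim_seq_const A)
    (is_lim_seq_minus' _ _ _ _ (t0 (Rpower p x)) (t0 p))).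
  now rewrite Rminus_diag, Rminus_0_r in h.
Qed.

Definition q_base (q : R) : R := Rmin q (/ q).

Lemma q_base_bounds (q : R) : 0 < q -> q <> 1 -> 0 < q_base q < 1.
Proof.
intros h0 h1. assert (0 < / q) by now apply Rinv_0_lt_compat.
assert (q * / q = 1) by (field; lra).
unfold q_base, Rmin. destruct (Rle_dec q (/ q)); split; nra.
Qed.

(** The quadratic term comes from the factor [q ^ (x (x - 1) / 2)], present
    only when [q > 1]. *)
Lemma ln_q_gamma (q : R) : 0 < q -> q <> 1 ->
  exists A B C, (q < 1 -> C = 0) /\ forall x, 0 < x ->
    ln (q_gamma q x) = A + B * x + C * x ^ 2 + log_qexp (q_base q) (Rpower (q_base q) x).
Proof.
intros h0 h1. assert (hb := q_base_bounds q h0 h1).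
unfold q_gamma. destruct (Rlt_dec q 1) as [hq | hq].
- assert (E : q_base q = q).
  { apply Rmin_left. assert (1 < / q) by (rewrite <- Rinv_1; apply Rinv_lt_contravar; lra). lra. }
  rewrite E in *.
  exists (ln (1 - q) - log_qexp q q), (- ln (1 - q)), 0. split; trivial. intros x hx.
  rewrite infinite_prod_q_gamma by trivial.
  rewrite ln_mult by (try apply exp_pos).
  unfold Rpower at 1. rewrite !ln_exp. ring.
- assert (hq' : 1 < q) by lra.
  assert (E : q_base q = / q).
  { apply Rmin_right. assert (/ q < 1) by (rewrite <- Rinv_1; apply Rinv_lt_contravar; lra). lra. }
  rewrite E in *.
  exists (ln (q - 1) - log_qexp (/ q) (/ q)), (- ln (q - 1) - / 2 * ln q), (/ 2 * ln q).
  split; [lra|]. intros x hx.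
  (* For [q > 1] the product is the one for [0 < q < 1] with base [1/q]. *)
  assert (F : infinite_prod (fun n : nat =>
      (1 - Rpower q (- (INR n + 1))) / (1 - Rpower q (- (INR n + x)))) =
    exp (log_qexp (/ q) (Rpower (/ q) x) - log_qexp (/ q) (/ q))).
  { rewrite <- infinite_prod_q_gamma by trivial. unfold infinite_prod. f_equal.
    apply Lim_seq_ext. intros N.
    assert (G : forall y, Rpower q (- y) = Rpower (/ q) y).
    { intros y. unfold Rpower. rewrite ln_Rinv by lra. f_equal. ring. }
    induction N as [|N IH]; simpl; rewrite ?IH, !G; reflexivity. }
  rewrite F, ln_mult, ln_mult by (try apply Rmult_lt_0_compat; apply exp_pos).
  unfold Rpower at 1 2. rewrite !ln_exp. field.
Qed.

(** * Derivatives of the q-psi function *)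

Lemma theta_log_coef (p : R) (m j : nat) :
  theta (S (S m)) (PS_Int (log_coef p)) j = psi_coef p (S m) j.
Proof.
destruct j as [|j].
- rewrite psi_coef_0. unfold theta. simpl. ring.
- unfold theta, PS_Int, log_coef, psi_coef, Rdiv. simpl pred.
  rewrite <- tech_pow_Rmult.
  replace (_ * (_ * _)) with (INR (S j) * / INR (S j) * (INR (S j) ^ S m * / (1 - p ^ S j)))
    by ring.
  rewrite Rinv_r by (apply not_0_INR; lia). ring.
Qed.

Lemma CV_radius_psi_coef (p : R) (m : nat) : 0 < p < 1 ->
  Rbar_le 1 (CV_radius (psi_coef p (S m))).
Proof.
intros hp. rewrite <- (CV_radius_ext _ _ (theta_log_coef p m)), CV_radius_theta, CV_radius_Int.
now apply CV_radius_log_coef.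
Qed.

(** The quadratic [A + B x + C x^2] is differentiated [m + 1] times. It disappears if [m >= 2]; for
    [m = 1] it leaves [2 C], which is 0 when [q < 1]. *)
Lemma Derive_n_q_psi (q x : R) (m : nat) : 0 < q -> q <> 1 -> 0 < x ->
  (1 <= m)%nat -> q < 1 \/ (2 <= m)%nat ->
  Derive_n (q_psi q) m x =
  ln (q_base q) ^ S m * PSeries (psi_coef (q_base q) m) (Rpower (q_base q) x).
Proof.
intros h0 h1 hx hm hmq.
assert (hp := q_base_bounds q h0 h1).
destruct (ln_q_gamma q h0 h1) as (A & B & C & hC & hln).
set (p := q_base q) in *. set (b := PS_Int (log_coef p)).
assert (hb : Rbar_le 1 (CV_radius b)).
{ unfold b. rewrite CV_radius_Int. now apply CV_radius_log_coef. }
assert (D1 : forall y, 0 < y ->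
  q_psi q y = B + 2 * C * y + ln p * PSeries (theta 1 b) (Rpower p y)).
{ intros y hy. apply is_derive_unique.
  apply is_derive_ext_loc with (fun x => A + B * x + C * x ^ 2 + log_qexp p (Rpower p x)).
  - apply locally_pos; trivial. intros z hz. symmetry. now apply hln.
  - assert (h := is_derive_n_PSeries_Rpower p b 1 y hp hb hy).
    change (is_derive (fun x => log_qexp p (Rpower p x)) y
      (ln p ^ 1 * PSeries (theta 1 b) (Rpower p y))) in h.
    rewrite pow_1 in h.
    apply (is_derive_plus (fun x => A + B * x + C * x ^ 2)
      (fun x => log_qexp p (Rpower p x)) y (B + 2 * C * y)); [|exact h].
    auto_derive; [trivial | ring]. }
assert (D2 : forall k y, 0 < y -> Derive_n (q_psi q) (S k) y =
  (match k with O => 2 * C | _ => 0 end)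
  + ln p ^ S (S k) * PSeries (theta (S (S k)) b) (Rpower p y)).
{ induction k as [|k IH]; intros y hy.
  - apply is_derive_unique.
    apply is_derive_ext_loc with
      (fun y => B + 2 * C * y + ln p * PSeries (theta 1 b) (Rpower p y)).
    + apply locally_pos; trivial. intros z hz. symmetry. now apply D1.
    + assert (h := is_derive_PSeries_Rpower p b 1 y hp hb hy).
      replace (ln p ^ 2) with (ln p * ln p) by ring. rewrite Rmult_assoc.
      apply (is_derive_plus (fun y => B + 2 * C * y)
        (fun y => ln p * PSeries (theta 1 b) (Rpower p y)) y (2 * C)).
      * auto_derive; [trivial | ring].
      * now apply (is_derive_scal (fun y => PSeries (theta 1 b) (Rpower p y))).
  - apply is_derive_unique.
    apply is_derive_ext_loc with (fun y => match k with O => 2 * C | _ => 0 end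
      + ln p ^ S (S k) * PSeries (theta (S (S k)) b) (Rpower p y)).
    + apply locally_pos; trivial. intros z hz. symmetry. now apply IH.
    + assert (h := is_derive_PSeries_Rpower p b (S (S k)) y hp hb hy).
      rewrite <- (tech_pow_Rmult (ln p) (S (S k))), (Rmult_comm (ln p)), Rmult_assoc.
      apply (is_derive_plus (fun y => match k with O => 2 * C | _ => 0 end)
        (fun y => ln p ^ S (S k) * PSeries (theta (S (S k)) b) (Rpower p y)) y 0).
      * apply (is_derive_const (match k with O => 2 * C | _ => 0 end)).
      * now apply (is_derive_scal (fun y => PSeries (theta (S (S k)) b) (Rpower p y))). }
destruct m as [|m]; [lia|].
rewrite D2, (PSeries_ext _ _ _ (theta_log_coef p m)) by trivial.
destruct m as [|m]; [|ring].
destruct hmq as [hq | hq]; [|lia]. rewrite hC by trivial. ring.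
Qed.

(** * Complete monotonicity from nonnegative coefficients *)

Lemma PSeries_nonneg (a : nat -> R) (z : R) :
  (forall k, 0 <= a k) -> 0 <= z -> ex_pseries a z -> 0 <= PSeries a z.
Proof.
intros ha hz hex. unfold PSeries.
rewrite <- (Rmult_0_l (Series (fun k => a k * z ^ k))), <- Series_scal_l.
apply Series_le; [|now apply ex_pseries_R].
intros k. rewrite Rmult_0_l. split; [lra|]. apply Rmult_le_pos; [apply ha | now apply pow_le].
Qed.

(** Each differentiation brings a factor [ln p < 0], compensated by the factor -1, and [theta] keeps
    coefficients nonnegative. *)
Lemma completely_monotonic_PSeries_Rpower (p : R) (g : nat -> R) (f : R -> R) :
  0 < p < 1 -> Rbar_le 1 (CV_radius g) -> (forall k, 0 <= g k) ->
  (forall x, 0 < x -> f x = PSeries g (Rpower p x)) ->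
  completely_monotonic 0 p_infty f.
Proof.
intros hp hg hpos hf x hx _ k. simpl in hx.
assert (h := is_derive_n_PSeries_Rpower p g k x hp hg hx).
assert (hl : locally x (fun y => PSeries g (Rpower p y) = f y)).
{ apply locally_pos; trivial. intros y hy. symmetry. now apply hf. }
split.
- apply ex_derive_n_ext_loc with (1 := hl). destruct k as [|k]; [exact I|].
  eexists. exact h.
- replace (Derive_n f k x) with (ln p ^ k * PSeries (theta k g) (Rpower p x)).
  2: { rewrite <- (is_derive_n_unique _ _ _ _ h). now apply Derive_n_ext_loc. }
  rewrite <- Rmult_assoc, <- Rpow_mult_distr.
  assert (hx1 := Rpower_lt_1 p x hp hx).
  apply Rmult_le_pos.
  + apply pow_le. assert (ln p < 0) by (rewrite <- ln_1; apply ln_increasing; lra). lra.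
  + apply PSeries_nonneg; [|lra|].
    * intros j. apply Rmult_le_pos; [apply pow_le, pos_INR | apply hpos].
    * apply CV_radius_inside, Rbar_lt_radius; [|lra]. now rewrite CV_radius_theta.
Qed.

Theorem corollary1p2 (q : R) (hq0 : 0 < q) (hq1 : q <> 1)
  (r m n s : nat)
  (hrm : (m <= r)%nat) (hmn : (n <= m)%nat) (hns : (s <= n)%nat)
  (hs : (1 <= s)%nat) (hsum : (r + s = m + n)%nat)
  (hcase : (0 < q < 1 /\ s = 1%nat) \/ s = 2%nat \/ (s = 3%nat /\ n = 4%nat)) :
  completely_monotonic (Finite 0) p_infty
    (fun x : R =>
       (-1) ^ (m + n) * Derive_n (q_psi q) m x * Derive_n (q_psi q) n x
       - alpha r m n s *
         ((-1) ^ (r + s) * Derive_n (q_psi q) r x * Derive_n (q_psi q) s x)).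
Proof.
assert (hp := q_base_bounds q hq0 hq1). set (p := q_base q) in *.
assert (hrad : forall k, (1 <= k)%nat -> Rbar_le 1 (CV_radius (psi_coef p k))).
{ intros [|k] hk; [lia|]. now apply CV_radius_psi_coef. }
assert (hpsi : forall k x, (s <= k)%nat -> 0 < x -> Derive_n (q_psi q) k x =
  ln p ^ S k * PSeries (psi_coef p k) (Rpower p x)).
{ intros k x hk hx. apply Derive_n_q_psi; trivial; [lia|].
  destruct hcase as [[h _] | h]; [left; lra | right; lia]. }
(* The exponent is [(m + 1) + (n + 1)], the total power of [ln p] in either product; the sign
   [(-1)^(m + n)] is absorbed since [(-1)^2 = 1]. *)
set (g := PS_scal ((- ln p) ^ (m + n + 2))
  (PS_minus (PS_mult (psi_coef p m) (psi_coef p n))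
    (PS_scal (alpha r m n s) (PS_mult (psi_coef p r) (psi_coef p s))))).
assert (ex1 : forall i j z, (s <= i)%nat -> (s <= j)%nat -> 0 <= z < 1 ->
  ex_pseries (PS_mult (psi_coef p i) (psi_coef p j)) z).
{ intros i j z hi hj hz. apply ex_pseries_mult; apply Rbar_lt_radius; trivial; apply hrad; lia. }
assert (ex2 : forall z, 0 <= z < 1 ->
  ex_pseries (PS_scal (alpha r m n s) (PS_mult (psi_coef p r) (psi_coef p s))) z).
{ intros z hz. apply ex_pseries_scal; [apply Rmult_comm | apply ex1; trivial; lia]. }
apply (completely_monotonic_PSeries_Rpower p g); trivial.
- apply CV_radius_ge_1. intros z hz.
  apply ex_pseries_scal; [apply Rmult_comm|]. apply ex_pseries_minus.
  + apply ex1; trivial; lia.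
  + now apply ex2.
- intros N. apply Rmult_le_pos.
  + apply pow_le. assert (ln p < 0) by (rewrite <- ln_1; apply ln_increasing; lra). lra.
  + assert (h := psi_coef_conv p r m n s N hp hrm hmn hns hs hsum ltac:(tauto)).
    change (0 <= PS_mult (psi_coef p m) (psi_coef p n) N
      + - (alpha r m n s * PS_mult (psi_coef p r) (psi_coef p s) N)). lra.
- intros x hx. assert (hz := Rpower_lt_1 p x hp hx).
  rewrite !hpsi by (trivial; lia).
  unfold g. rewrite PSeries_scal, PSeries_minus, PSeries_scal, !PSeries_mult.
  2-5: apply Rbar_lt_radius; [apply hrad; lia | lra].
  2: apply ex1; [lia | lia | lra].
  2: apply ex2; lra.
  replace (- ln p) with (-1 * ln p) by ring.
  rewrite Rpow_mult_distr, !pow_add, <- !tech_pow_Rmult.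
  (* Here [r + s = m + n] gives both products the same power of [ln p] and the same sign. *)
  assert (E : ln p ^ r * ln p ^ s = ln p ^ m * ln p ^ n).
  { rewrite <- !pow_add. now f_equal. }
  assert (E' : (-1) ^ r * (-1) ^ s = (-1) ^ m * (-1) ^ n).
  { rewrite <- !pow_add. now f_equal. }
  rewrite E'.
  set (sg := (-1) ^ m * (-1) ^ n).
  transitivity (sg * ln p ^ 2 * (ln p ^ m * ln p ^ n *
    (PSeries (psi_coef p m) (Rpower p x) * PSeries (psi_coef p n) (Rpower p x))
    - alpha r m n s * (ln p ^ r * ln p ^ s *
    (PSeries (psi_coef p r) (Rpower p x) * PSeries (psi_coef p s) (Rpower p x))))); [ring|].
  rewrite E. unfold sg. ring.
Qed.
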